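(* Let $G$ be an abelian group, let $G_*:=G\cup\{0\}$ be the monoid obtained by adjoining a base point $0$ to $G$, and let $A$ be a monoid contained in $G_*$ (a submonoid). Then the set of all valuation monoids containing $A$ and having group completion $G_*$, endowed with the hull-kernel topology (as a subspace of the power set $2^{G_*}$), is a spectral space.
   Context: A monoid means a commutative monoid, written multiplicatively, with identity $1$ and a base point $0$ satisfying $0\cdot a=0$ for all $a$; in $G_*$ one has $g\cdot 0=0$ for all $g$. A monoid $B$ is cancellative if for $a,b,c\in B$ with $a\neq0$, $ab=ac$ implies $b=c$. The group completion $B^+$ of a cancellative monoid $B$ is the localization of $B$ at the multiplicative set $B\setminus\{0\}$; $B\subseteq B^+$. A submonoid $B\subseteq G_*$ (containing $0,1$) has group completion $G_*$ if every element of $G_*$ is of the form $a/b$ with $a,b\in B$, $b\neq0$. A monoid $B$ is a valuation monoid if it is cancellative and for every nonzero $\alpha\in B^+$ at least one of $\alpha,1/\alpha$ belongs to $B$. The valuation monoids considered are submonoids of $G_*$. The hull-kernel topology on $2^S$ for a set $S$ has open subbasis the sets $\{R\subseteq S\mid F\nsubseteq R\}$, $F\subseteq S$ finite. A topological space is spectral if it is homeomorphic to the prime spectrum of a commutative ring with the Zariski topology. *)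

(* Defs.v *)
From HB Require Import structures.
From mathcomp Require Import all_boot all_algebra.
From mathcomp Require Import all_classical topology.

Set Implicit Arguments.
Unset Strict Implicit.
Unset Printing Implicit Defensive.

Local Open Scope classical_set_scope.

(** * The monoid with base point obtained from a group *)

(** [None] is the base point; groups are written multiplicatively. *)
Definition adjoin0 (G : Type) : Type := option G.

Definition bp {G : Type} : adjoin0 G := None.

HB.instance Definition _ (G : choiceType) := Choice.copy (adjoin0 G) (option G).

Section Adjoin0Monoid.
Local Open Scope group_scope.
Variable G : monoidType.
Implicit Types x y z : adjoin0 G.

Definition adjoin0_mul x y : adjoin0 G :=
  if x is Some g then if y is Some h then Some (g * h) else None else None.

Lemma adjoin0_mulA : associative adjoin0_mul.
Proof. by move=> [x|] [y|] [z|] //=; rewrite mulgA. Qed.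

Lemma adjoin0_mul1 : left_id (Some 1) adjoin0_mul.
Proof. by move=> [x|] //=; rewrite mul1g. Qed.

Lemma adjoin0_mulr1 : right_id (Some 1) adjoin0_mul.
Proof. by move=> [x|] //=; rewrite mulg1. Qed.

HB.instance Definition _ := isMonoid.Build (adjoin0 G)
  adjoin0_mulA adjoin0_mul1 adjoin0_mulr1.

Lemma mul0x x : bp * x = bp. Proof. by []. Qed.
Lemma mulx0 x : x * bp = bp. Proof. by case: x. Qed.

End Adjoin0Monoid.

(** The inverse of the base point is the base point, by convention; below,
    only nonzero elements are inverted. *)
Definition adjoin0_inv (G : groupType) (x : adjoin0 G) : adjoin0 G :=
  if x is Some g then Some (g^-1)%g else None.

HB.instance Definition _ (G : groupType) :=
  hasInv.Build (adjoin0 G) (@adjoin0_inv G).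

(** * Submonoids, group completions and valuation monoids *)

Section ValuationMonoids.
Local Open Scope group_scope.
Variable G : groupType.
Implicit Types A B : set (adjoin0 G).

Definition submonoid B : Prop :=
  [/\ B bp, B 1 & forall x y, B x -> B y -> B (x * y)].

Definition cancellative B : Prop :=
  forall a b c, B a -> B b -> B c -> a <> bp -> a * b = a * c -> b = c.

(** The localization of [B] at its nonzero elements, realized inside [adjoin0 G]
    as the set of fractions; [completion_eq] below shows that the fractions are
    identified exactly as in the localization. *)
Definition completion B : set (adjoin0 G) :=
  [set x | exists a b, [/\ B a, B b, b <> bp & x = a / b]].

Definition valuation_monoid B : Prop :=
  [/\ submonoid B, cancellative B &
      forall x, completion B x -> x <> bp -> B x \/ B x^-1].

Definition valuation_monoids_over A : set (set (adjoin0 G)) :=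
  [set B | [/\ valuation_monoid B, A `<=` B & completion B = setT]].

Lemma completion_eq B a b c d : (forall x y : G, x * y = y * x) ->
    submonoid B -> B a -> B b -> B c -> B d -> b <> bp -> d <> bp ->
  a / b = c / d <-> exists s, [/\ B s, s <> bp & s * (a * d) = s * (c * b)].
Proof.
move=> GC [_ B1 _] _ _ _ _.
case: b d => [b|//] [d|//] _ _; split=> [e|[s [_ s0]]].
- exists 1; split=> //; rewrite !mul1g; move: e.
  case: a c => [a|] [c|] //= [e]; congr Some.
  apply: (mulIg b^-1); apply: (mulIg d^-1).
  by rewrite mulgK -(mulgA a) (GC d) mulgA mulgK.
- case: s s0 => [s|//] _; case: a c => [a|] [c|] //= [/mulgI e]; congr Some.
  apply: (mulIg b); apply: (mulIg d).
  by rewrite mulgVK e -!mulgA (GC b d) mulKg.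
Qed.

End ValuationMonoids.

(** * The hull-kernel topology on a power set *)

Definition hk_powerset (S : Type) : Type := set S.

HB.instance Definition _ (S : Type) := Choice.copy (hk_powerset S) (set S).

HB.instance Definition _ (S : Type) :=
  @isSubBaseTopological.Build (hk_powerset S) (set S) (@finite_set S)
    (fun F => [set R | ~ F `<=` R]).

(** * Spectral spaces *)

Section PrimeSpectrum.
Local Open Scope ring_scope.
Variable R : comPzRingType.

(** The ideals of [ring_quotient] live over nontrivial rings only; here the zero
    ring is allowed, so that the empty space is a prime spectrum. *)
Definition prime_ideal (P : set R) : Prop :=
  [/\ P 0, (forall x y, P x -> P y -> P (x + y)),
      (forall a x, P x -> P (a * x)), ~ P 1 &
      forall x y, P (x * y) -> P x \/ P y].

Definition Spec : Type := {P : set R | prime_ideal P}.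

HB.instance Definition _ := gen_eqMixin Spec.
HB.instance Definition _ := gen_choiceMixin Spec.

Definition zariski_open : set_system Spec :=
  [set U | exists E : set R, ~` U = [set P | E `<=` sval P]].

Lemma zariski_openT : zariski_open setT.
Proof.
exists setT; rewrite setCT; apply/seteqP; split=> // -[P [_ _ _ P1 _]] /= sP.
by apply: P1; apply: sP.
Qed.

Lemma zariski_openI : setI_closed zariski_open.
Proof.
move=> U V [E eE] [F eF].
exists [set x * y | x in E & y in F].
rewrite setCI eE eF; apply/seteqP; split=> -[P pP] /=.
  case: pP => _ _ PM _ _ [EP|FP] _ [x Ex [y Fy <-]].
    by rewrite GRing.mulrC; apply: PM; apply: EP.
  by apply: PM; apply: FP.
move=> EFP; apply: contrapT => /not_orP[/existsNP[x /not_implyP[Ex nPx]]].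
move=> /existsNP[y /not_implyP[Fy nPy]].
have /EFP : [set x * y | x in E & y in F] (x * y) by exists x => //; exists y.
by case: pP => _ _ _ _ /[apply] -[].
Qed.

Lemma zariski_open_bigcup (I : Type) (U : I -> set Spec) :
  (forall i, zariski_open (U i)) -> zariski_open (\bigcup_i U i).
Proof.
move=> /choice[E eE]; exists (\bigcup_i E i); rewrite setC_bigcup.
apply/seteqP; split=> P /=.
  by move=> UP x [i _ Ex]; have := UP i Logic.I; rewrite eE; apply.
by move=> EP i _; rewrite eE => x Ex; apply: EP; exists i.
Qed.

HB.instance Definition _ := isOpenTopological.Build Spec
  zariski_openT zariski_openI zariski_open_bigcup.

End PrimeSpectrum.

Definition homeomorphic (X Y : topologicalType) : Prop :=
  exists (f : X -> Y) (g : Y -> X),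
    [/\ cancel f g, cancel g f, continuous f & continuous g].

Definition spectral_space (X : topologicalType) : Prop :=
  exists R : comPzRingType, homeomorphic X (Spec R).

(* Main.v *)
Require Import Defs.
From HB Require Import structures.
From mathcomp Require Import all_boot all_algebra.
From mathcomp Require Import finmap all_classical topology.
From mathcomp Require Import ring.

(** Let [X] be the set of valuation monoids in question. A subset [B] of
    [adjoin0 G] belongs to [X] when it is a submonoid containing [A] and contains
    [g] or its inverse for every [g] in [G] ([valuation_monoids_overP]). Each of
    these conditions concerns finitely many elements, so [X] is closed in the
    power set for the product topology: a limit of points of [X] along an
    ultrafilter is in [X] ([ultrafilter_limit_valuation_monoid]). The hull-kernel
    topology is generated by the sets [U x] of all [B] such that [~ B x]. Hence
    [X] is a [T0] space with a subbase [U] for which the patch topology,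
    generated by the [U x] and their complements, is compact. Such spaces are
    spectral by a theorem of Hochster ([patch_compact_spectral]). The point is to
    find a commutative ring whose spectrum is [X].

    Let [K] be the field of rational functions in one variable [T i] for each
    member [U i] of the subbase. A point [x] defines a valuation of [K]: multiply
    by [s] the variables [T i] such that [x] is not in [U i], and take the order
    at [s = 0]. The residue of a rational function of nonnegative order, its
    value at [s = 0] after this substitution, is again an element of [K].
    The ring [spring] consists of the functions [f] from [X] to [K] that
    are locally constant for the patch topology and satisfy: if [x] is a
    specialization of [y], then [f x] is the residue of [f y] at [x]. The
    function equal to [T i] on [U i] and to [0] elsewhere is one of them.

    The support of such an [f] is open: it is patch-constructible and stable
    under generization, since the residue of [0] is [0]. The main point is
    [spring_dvd_exp]: if the support of [f] is contained in the support of [g],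
    then [g] divides a power of [f]. The quotient [f ^+ n / g], extended by [0],
    is compatible with specialization as soon as [n] exceeds all the valuations
    of the nonzero values of [g]. There is such an [n] because [g] has finitely many
    values, and because the valuations of a rational function are bounded
    independently of the point by the degree of its numerator
    ([residue_exp_div_uniform]). Since [K] is formally real, sums of
    squares turn finite unions of supports into supports. So a prime ideal
    behaves like a consistent set of patch-clopen conditions, and by compactness
    it consists of the functions vanishing at some point ([spring_prime_point]).
    The supports form a base of the topology of [X], which is therefore
    homeomorphic to the spectrum. *)

Set Implicit Arguments.
Unset Strict Implicit.
Unset Printing Implicit Defensive.

Import GRing.Theory Num.Theory.
Local Open Scope classical_set_scope.
Local Open Scope ring_scope.

(** * Polynomial functions in arbitrarily many variables *)

Lemma poly_eq0_on_rat (p : {poly rat}) : (forall s, p.[s] = 0) -> p = 0.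
Proof.
move=> p0; apply: contrapT => /eqP pn0.
have := max_poly_roots (rs := [seq n%:R | n <- iota 0 (size p)]) pn0.
rewrite size_map size_iota ltnn map_inj_uniq ?iota_uniq; last first.
  by move=> m n /eqP; rewrite eqr_nat => /eqP.
by move=> H; suff: false by []; apply: H => //; apply/allP => s _; rewrite rootE p0.
Qed.

Section PolynomialFunctions.
Variable I : Type.

(** Polynomials with integer coefficients in variables indexed by [I], encoded as
    functions on rational points: a nonzero element then comes with a point where
    it does not vanish, whatever the size of [I]. *)
Inductive is_polyfun : ((I -> rat) -> rat) -> Prop :=
| is_polyfun1 : is_polyfun 1
| is_polyfun_var i : is_polyfun (fun a => a i)
| is_polyfunB p q : is_polyfun p -> is_polyfun q -> is_polyfun (p - q)
| is_polyfunM p q : is_polyfun p -> is_polyfun q -> is_polyfun (p * q).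

Definition polyfun_pred : {pred (I -> rat) -> rat} :=
  fun p => `[< is_polyfun p >].

Lemma polyfun_subring : subring_closed polyfun_pred.
Proof.
split; first by apply/asboolP; apply: is_polyfun1.
- by move=> p q /asboolP Pp /asboolP Pq; apply/asboolP; apply: is_polyfunB.
- by move=> p q /asboolP Pp /asboolP Pq; apply/asboolP; apply: is_polyfunM.
Qed.

Definition polyfun : Type := {p | polyfun_pred p}.

HB.instance Definition _ := SubChoice.on polyfun.
HB.instance Definition _ :=
  GRing.SubChoice_isSubComPzRing.Build _ _ polyfun polyfun_subring.

Definition polyfun_eval (a : I -> rat) (p : polyfun) : rat := val p a.

Lemma polyfun_eval_zmod a : zmod_morphism (polyfun_eval a).
Proof. by []. Qed.

Lemma polyfun_eval_monoid a : monoid_morphism (polyfun_eval a).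
Proof. by []. Qed.

HB.instance Definition _ a := GRing.isZmodMorphism.Build polyfun rat
  (polyfun_eval a) (polyfun_eval_zmod a).
HB.instance Definition _ a := GRing.isMonoidMorphism.Build polyfun rat
  (polyfun_eval a) (polyfun_eval_monoid a).

Lemma polyfun_oner_neq0 : 1 != 0 :> polyfun.
Proof.
by apply/eqP => /(congr1 (polyfun_eval (fun=> 0))); rewrite rmorph1 rmorph0.
Qed.

HB.instance Definition _ :=
  GRing.PzSemiRing_isNonZero.Build polyfun polyfun_oner_neq0.

Lemma polyfun_eqP (p q : polyfun) :
  (forall a, polyfun_eval a p = polyfun_eval a q) -> p = q.
Proof. by move=> pq; apply/val_inj/funext. Qed.

(** Restriction to the line through [a] with direction [b] gives a polynomial in
    one variable; this transfers the absence of zero divisors from one variable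
    to many. *)
Lemma polyfun_line (p : polyfun) (a b : I -> rat) :
  exists P : {poly rat},
    forall t, polyfun_eval (fun i => a i + t * b i) p = P.[t].
Proof.
case: p => p pP; rewrite /polyfun_eval /=; move/asboolP: pP.
elim=> [|i|{}p q _ [P eP] _ [Q eQ]|{}p q _ [P eP] _ [Q eQ]].
- by exists 1 => t; rewrite hornerE.
- by exists ((a i)%:P + (b i) *: 'X) => t; rewrite !hornerE mulrC.
- by exists (P - Q) => t; rewrite !hornerE -eP -eQ.
- by exists (P * Q) => t; rewrite !hornerE -eP -eQ.
Qed.

Lemma polyfun_mulf_eq0 (p q : polyfun) :
  p * q = 0 -> (p == 0) || (q == 0).
Proof.
move=> pq0; apply: contrapT => /negP; rewrite negb_or => /andP[pn0 qn0].
have nz (r : polyfun) : r != 0 -> exists a, polyfun_eval a r != 0.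
  move=> rn0; apply: contrapT => /forallNP r0; move/eqP: rn0; apply.
  by apply: polyfun_eqP => a; rewrite rmorph0; apply/eqP/negPn/negP/r0.
have [a pa] := nz _ pn0; have [b qb] := nz _ qn0.
(* On the line through [a] and [b] neither factor vanishes identically. *)
have [P eP] := polyfun_line p a (fun i => b i - a i).
have [Q eQ] := polyfun_line q a (fun i => b i - a i).
have : P * Q = 0.
  apply: poly_eq0_on_rat => t.
  by rewrite hornerM -eP -eQ -rmorphM pq0 rmorph0.
move/eqP; rewrite mulf_eq0 => /orP[]/eqP e; [move: pa|move: qb].
- have := eP 0; rewrite e horner0 => <-; apply/negP/negPn/eqP; congr polyfun_eval.
  by apply: funext => i; rewrite mul0r addr0.
- have := eQ 1; rewrite e horner0 => <-; apply/negP/negPn/eqP; congr polyfun_eval.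
  by apply: funext => i; rewrite mul1r addrC subrK.
Qed.

Definition polyfun_unit : pred polyfun := fun p => `[< exists q, q * p = 1 >].

Definition polyfun_inv (p : polyfun) : polyfun :=
  if pselect (exists q, q * p = 1) is left e then projT1 (cid e) else p.

Lemma polyfun_mulVr : {in polyfun_unit, left_inverse 1 polyfun_inv *%R}.
Proof.
move=> p /asboolP pU; rewrite /polyfun_inv; case: pselect => // e.
exact: (projT2 (cid e)).
Qed.

Lemma polyfun_unitPl (p q : polyfun) : q * p = 1 -> polyfun_unit p.
Proof. by move=> e; apply/asboolP; exists q. Qed.

Lemma polyfun_inv_out : {in [predC polyfun_unit], polyfun_inv =1 id}.
Proof.
move=> p /negP pU; rewrite /polyfun_inv; case: pselect => // e.
by case: pU; apply/asboolP.
Qed.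

HB.instance Definition _ := GRing.ComNzRing_hasMulInverse.Build polyfun
  polyfun_mulVr polyfun_unitPl polyfun_inv_out.
HB.instance Definition _ := GRing.ComUnitRing_isIntegral.Build polyfun
  polyfun_mulf_eq0.

Definition polyfun_var i : polyfun :=
  Sub (fun a : I -> rat => a i) (asboolT (is_polyfun_var i)).

(** The dilation multiplies by [s] the variables outside [x]; the place attached
    to [x] is the limit [s -> 0]. *)
Definition dilate (x : set I) (s : rat) (a : I -> rat) : I -> rat :=
  fun i => if `[< x i >] then a i else s * a i.

Definition dilation_spec (x : set I) (p : polyfun) (P : {poly polyfun}) : Prop :=
  forall a s, polyfun_eval (dilate x s a) p = (map_poly (polyfun_eval a) P).[s].

(** The bound [d] on the degree in [s] does not depend on [x]: it bounds the
    orders of vanishing of [p] at all the places simultaneously. *)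
Lemma dilation_exists (p : polyfun) : exists d, forall x, exists P,
  dilation_spec x p P /\ (size P <= d)%N.
Proof.
case: p => p pP; have /asboolP := pP => ip.
elim: ip pP => [|i|{}p q ip IHp iq IHq|{}p q ip IHp iq IHq] pP.
- exists 1%N => x; exists 1; split; last by rewrite size_poly1.
  by move=> a s; rewrite rmorph1 hornerE.
- exists 2%N => x; exists (if `[< x i >] then (polyfun_var i)%:P
                      else polyfun_var i *: 'X); split; last first.
    case: ifP => _; last by rewrite (leq_trans (size_scale_leq _ _)) ?size_polyX.
    by rewrite (leq_trans (size_polyC_leq1 _)).
  move=> a s; rewrite [LHS]/polyfun_eval /= /dilate.
  case: ifP => _; first by rewrite map_polyC hornerC.
  by rewrite map_polyZ map_polyX hornerZ hornerX mulrC.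
- have [d Hd] := IHp (asboolT ip); have [e He] := IHq (asboolT iq).
  exists (maxn d e) => x; have [P [eP sP]] := Hd x; have [Q [eQ sQ]] := He x.
  exists (P - Q); split.
    by move=> a s; rewrite rmorphB hornerD hornerN -eP -eQ.
  rewrite (leq_trans (size_polyD _ _)) // size_polyN geq_max.
  by rewrite (leq_trans sP) ?leq_maxl // (leq_trans sQ) ?leq_maxr.
- have [d Hd] := IHp (asboolT ip); have [e He] := IHq (asboolT iq).
  exists (d + e)%N => x; have [P [eP sP]] := Hd x; have [Q [eQ sQ]] := He x.
  exists (P * Q); split.
    by move=> a s; rewrite rmorphM hornerM -eP -eQ.
  rewrite (leq_trans (size_polyMleq _ _)) // (leq_trans (leq_pred _)) //.
  exact: leq_add.
Qed.

Lemma dilation_uniq x p P Q :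
  dilation_spec x p P -> dilation_spec x p Q -> P = Q.
Proof.
move=> eP eQ; apply/polyP => j; apply: polyfun_eqP => a.
suff PQ : map_poly (polyfun_eval a) P = map_poly (polyfun_eval a) Q.
  by rewrite -!coef_map PQ.
apply/eqP; rewrite -subr_eq0; apply/eqP.
by apply: poly_eq0_on_rat => s; rewrite !hornerE -eP -eQ subrr.
Qed.

Lemma dilation_exists1 x p : exists P, dilation_spec x p P.
Proof. by have [d /(_ x)[P [eP _]]] := dilation_exists p; exists P. Qed.

(** The ring morphism sending a variable [T i] to itself when [x i] and to
    [T i *: 'X] otherwise ([dilation_var]), ['X] being the dilation factor. *)
Definition dilation x p : {poly polyfun} := projT1 (cid (dilation_exists1 x p)).

Lemma dilationP x p : dilation_spec x p (dilation x p).
Proof. exact: (projT2 (cid (dilation_exists1 x p))). Qed.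

Lemma dilation_zmod x : zmod_morphism (dilation x).
Proof.
move=> p q; apply: (dilation_uniq (dilationP x _)) => a s.
by rewrite !rmorphB hornerD hornerN -!dilationP.
Qed.

Lemma dilation_monoid x : monoid_morphism (dilation x).
Proof.
split=> [|p q]; apply: (dilation_uniq (dilationP x _)) => a s.
  by rewrite !rmorph1 hornerE.
by rewrite !rmorphM hornerM -!dilationP.
Qed.

HB.instance Definition _ x := GRing.isZmodMorphism.Build polyfun {poly polyfun}
  (dilation x) (dilation_zmod x).
HB.instance Definition _ x := GRing.isMonoidMorphism.Build polyfun {poly polyfun}
  (dilation x) (dilation_monoid x).

Lemma dilation_var x i : dilation x (polyfun_var i) =
  if `[< x i >] then (polyfun_var i)%:P else polyfun_var i *: 'X.
Proof.
apply: (dilation_uniq (dilationP x _)) => a s.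
rewrite [LHS]/polyfun_eval /= /dilate.
case: ifP => _; first by rewrite map_polyC hornerC.
by rewrite map_polyZ map_polyX hornerZ hornerX mulrC.
Qed.

Lemma dilation_at1 x p : (dilation x p).[1] = p.
Proof.
apply: polyfun_eqP => a.
rewrite -horner_map rmorph1 -dilationP; congr polyfun_eval.
by apply: funext => i; rewrite /dilate mul1r; case: ifP.
Qed.

Lemma dilation_size p : exists d, forall x, (size (dilation x p) <= d)%N.
Proof.
have [d Hd] := dilation_exists p; exists d => x.
by have [P [eP]] := Hd x; rewrite (dilation_uniq (dilationP x p) eP).
Qed.

End PolynomialFunctions.

Local Notation "p %:F" := (FracField.tofrac p).

(** * Places of the field of rational functions *)

Lemma fractionP (R : idomainType) (z : {fraction R}) :
  exists p q : R, q != 0 /\ z = p%:F / q%:F.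
Proof.
elim/quotW: z => r; exists (\n_r), (\d_r); have dn0 := denom_ratioP r.
split=> //; apply: (canRL (mulfK _)); first by rewrite tofrac_eq0.
rewrite /FracField.tofrac; unlock; rewrite -[LHS]/(FracField.mul _ _).
rewrite -FracField.pi_mul; apply/eqmodP; rewrite /= FracField.equivfE.
by rewrite /FracField.mulf !numden_Ratio ?oner_neq0 ?mulr1 ?mul1r // mulrC.
Qed.

Lemma sum_sqr_div_eq0 (F : fieldType) (a b c d : F) : b != 0 -> d != 0 ->
  (a / b) ^+ 2 + (c / d) ^+ 2 = 0 -> (a * d) ^+ 2 + (c * b) ^+ 2 = 0.
Proof.
move=> bn0 dn0 e.
transitivity (((a / b) ^+ 2 + (c / d) ^+ 2) * (b * d) ^+ 2).
  by field; rewrite ?bn0 ?dn0.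
by rewrite e mul0r.
Qed.

Section Residues.
Variables (R : idomainType) (phi : {rmorphism R -> {poly R}}).
Local Notation K := {fraction R}.
Implicit Types (z c t : K).

(** An injective [phi] extends to fractions, with values in the fractions of
    polynomials. The image of [z] is required to be [P / Q] with [Q.[0] != 0],
    and [c] to be its value at [0]: this is the graph of a ring morphism defined
    on a valuation ring, and working with the graph avoids extending [phi]. *)
Definition residue z c : Prop :=
  exists (p q : R) (P Q : {poly R}),
    [/\ q != 0, Q.[0] != 0, z = p%:F / q%:F, c = P.[0]%:F / Q.[0]%:F &
        phi p * Q = P * phi q].

Lemma residue1 : residue 1 1.
Proof.
exists 1, 1, 1, 1; rewrite !hornerE tofrac1 invr1.
by split=> //; apply: oner_neq0.
Qed.

Lemma residueB z c z' c' :
  residue z c -> residue z' c' -> residue (z - z') (c - c').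
Proof.
move=> [p [q [P [Q [qn0 Qn0 -> -> e]]]]] [p' [q' [P' [Q' [q'n0 Q'n0 -> -> e']]]]].
exists (p * q' - p' * q), (q * q'), (P * Q' - P' * Q), (Q * Q').
split; rewrite ?hornerM ?mulf_neq0 //.
- by rewrite tofracB !tofracM -mulNr addf_div ?tofrac_eq0 // mulNr.
- rewrite hornerD hornerN !hornerM tofracB !tofracM.
  by rewrite -mulNr addf_div ?tofrac_eq0 // mulNr.
- rewrite rmorphB !rmorphM /= !mulrBl; congr (_ - _).
    by transitivity ((phi p * Q) * (phi q' * Q')); [|rewrite e]; ring.
  by transitivity ((phi p' * Q') * (phi q * Q)); [|rewrite e']; ring.
Qed.

Lemma residueM z c z' c' :
  residue z c -> residue z' c' -> residue (z * z') (c * c').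
Proof.
move=> [p [q [P [Q [qn0 Qn0 -> -> e]]]]] [p' [q' [P' [Q' [q'n0 Q'n0 -> -> e']]]]].
exists (p * p'), (q * q'), (P * P'), (Q * Q').
split; rewrite ?hornerM ?tofracM ?mulf_neq0 ?mulf_div //.
by rewrite !rmorphM /= mulrACA e e' mulrACA.
Qed.

Hypothesis phi_at1 : forall p, (phi p).[1] = p.

Lemma morph_eq0 p : (phi p == 0) = (p == 0).
Proof.
by apply/eqP/eqP => [e|->]; [rewrite -(phi_at1 p) e horner0|rewrite rmorph0].
Qed.

Lemma residue_uniq z c c' : residue z c -> residue z c' -> c = c'.
Proof.
move=> [p [q [P [Q [qn0 Qn0 -> -> e]]]]] [p' [q' [P' [Q' [q'n0 Q'n0 + -> e']]]]].
move/eqP; rewrite eqr_div ?tofrac_eq0 // -!tofracM tofrac_eq => /eqP pq.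
suff PQ : P * Q' = P' * Q.
  apply/eqP; rewrite eqr_div ?tofrac_eq0 // -!tofracM tofrac_eq -!hornerM.
  by rewrite PQ.
apply: (mulIf (x := phi (q * q'))); first by rewrite morph_eq0 mulf_neq0.
rewrite rmorphM /=.
transitivity ((phi p * Q) * (phi q' * Q')); first by rewrite e; ring.
transitivity (phi (p * q') * (Q * Q')); first by rewrite rmorphM /=; ring.
rewrite pq rmorphM /=.
by transitivity ((phi p' * Q') * (phi q * Q)); [|rewrite e']; ring.
Qed.

Lemma residueV z c : c != 0 -> residue z c -> residue z^-1 c^-1.
Proof.
move=> cn0 [p [q [P [Q [qn0 Qn0 ez ec e]]]]].
have Pn0 : P.[0] != 0 by apply: contraNneq cn0 => P0; rewrite ec P0 rmorph0 mul0r.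
have pn0 : p != 0.
  apply: contraNneq Pn0 => p0; move/eqP: e; rewrite p0 rmorph0 mul0r eq_sym.
  by rewrite mulf_eq0 morph_eq0 (negPf qn0) orbF => /eqP->; rewrite horner0.
exists q, p, Q, P; rewrite ez ec !invf_div; split=> //.
by rewrite mulrC -e mulrC.
Qed.

(** An element of residue [0] has valuation at least [1], whereas [p / q] has
    valuation at most the degree of [phi p]. As [d] exceeds this degree, the
    quotient of the power [d] of the former by the latter has residue [0]. *)
Lemma residue_exp_div p q d t : p != 0 -> q != 0 ->
    (size (phi p) <= d)%N -> residue t 0 ->
  residue (t ^+ d / (p%:F / q%:F)) 0.
Proof.
move=> pn0 qn0 Hd [r [s [P [Q [sn0 Qn0 -> + e]]]]].
move/esym/eqP; rewrite mulf_eq0 invr_eq0 !tofrac_eq0 (negPf Qn0) orbF => P0.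
have [P' eP] : exists P', P = P' * 'X.
  by have /factor_theorem[P' ->] := P0; exists P'; rewrite subr0.
(* [m] is the order of [phi p] at [0], and [p'] its unit part. *)
have [m [p']] := multiplicity_XsubC (phi p) 0.
rewrite morph_eq0 pn0 /= subr0 => p'n0 ep.
have p'n00 : p' != 0 by apply: contraNneq p'n0 => ->; rewrite root0.
have md : (m < d)%N.
  apply: leq_trans Hd; rewrite ep size_Mmonic ?monicXn //.
  by rewrite size_polyXn addnS /= -[X in (X < _)%N]add0n ltn_add2r size_poly_gt0.
exists (r ^+ d * q), (s ^+ d * p), (P' ^+ d * 'X^(d - m) * phi q), (Q ^+ d * p').
split.
- by rewrite mulf_neq0 ?expf_neq0.
- by rewrite hornerM horner_exp mulf_neq0 ?expf_neq0.
- by rewrite !tofracM !tofracXn expr_div_n invf_div mulf_div.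
- rewrite !hornerM hornerXn expr0n subn_eq0 leqNgt md mulr0 mul0r tofrac0.
  by rewrite mul0r.
- rewrite !rmorphM !rmorphXn /= ep.
  transitivity ((phi r * Q) ^+ d * phi q * p'); first by rewrite exprMn; ring.
  have eX : 'X^d = 'X^(d - m) * 'X^m :> {poly R} by rewrite -exprD subnK // ltnW.
  by rewrite e eP !exprMn eX; ring.
Qed.

End Residues.

(** A field with one valuation ring for each [x : set I], given by the
    graph [residue_at x] of a residue map that has values in the field itself.
    The coordinates in [x] are fixed by the residue map and the others are sent
    to [0]. The crucial axiom is [residue_at_exp_div], whose exponent is uniform
    in [x]; [sum_sqr_eq0] makes the common zeros of two functions to the field
    the zeros of a single one. *)
Record place_family (I : Type) := PlaceFamily {
  field_of :> fieldType;
  coordinate : I -> field_of;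
  residue_at : set I -> field_of -> field_of -> Prop;
  coordinate_neq0 : forall i, coordinate i != 0;
  residue_at1 : forall x, residue_at x 1 1;
  residue_atB : forall x z c z' c', residue_at x z c -> residue_at x z' c' ->
    residue_at x (z - z') (c - c');
  residue_atM : forall x z c z' c', residue_at x z c -> residue_at x z' c' ->
    residue_at x (z * z') (c * c');
  residue_atV : forall x z c, c != 0 -> residue_at x z c ->
    residue_at x z^-1 c^-1;
  residue_at_uniq : forall x z c c', residue_at x z c -> residue_at x z c' ->
    c = c';
  residue_at_coordinate : forall x i,
    residue_at x (coordinate i) (if `[< x i >] then coordinate i else 0);
  residue_at_exp_div : forall z, z != 0 -> exists n, forall x t,
    residue_at x t 0 -> residue_at x (t ^+ n / z) 0;
  sum_sqr_eq0 : forall z t : field_of, z ^+ 2 + t ^+ 2 = 0 -> z = 0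
}.

Section RationalFunctions.
Variable I : Type.
Local Notation K := {fraction polyfun I}.
Implicit Types (x : set I) (z c t : K).

Definition var i : K := (polyfun_var i)%:F.

Lemma residue_var x i :
  residue (dilation x) (var i) (if `[< x i >] then var i else 0).
Proof.
exists (polyfun_var i), 1,
  (if `[< x i >] then (polyfun_var i)%:P else polyfun_var i *: 'X), 1.
rewrite hornerC tofrac1 !divr1 rmorph1 !mulr1 /= dilation_var.
split=> //; [exact: oner_neq0|exact: oner_neq0|].
by case: ifP => _; rewrite ?hornerC // hornerZ hornerX mulr0 tofrac0.
Qed.

Lemma residue_exp_div_uniform z : z != 0 -> exists n, forall x t,
  residue (dilation x) t 0 -> residue (dilation x) (t ^+ n / z) 0.
Proof.
have [p [q [qn0 ->]]] := fractionP z => pqn0.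
have pn0 : p != 0 by apply: contraNneq pqn0 => ->; rewrite tofrac0 mul0r.
have [d Hd] := dilation_size p; exists d => x t.
exact: (residue_exp_div (dilation_at1 x) pn0 qn0 (Hd x)).
Qed.

(** Squares of rational values at a point cannot cancel each other. *)
Lemma fraction_sum_sqr_eq0 z t : z ^+ 2 + t ^+ 2 = 0 -> z = 0.
Proof.
have [p [q [qn0 ->]]] := fractionP z; have [r [s [sn0 ->]]] := fractionP t.
move=> e.
suff /eqP : p * s = 0.
  by rewrite mulf_eq0 (negPf sn0) orbF => /eqP->; rewrite tofrac0 mul0r.
have {}e : (p * s) ^+ 2 + (r * q) ^+ 2 = 0.
  apply/eqP; rewrite -tofrac_eq0 tofracD !tofracXn !tofracM; apply/eqP.
  by apply: sum_sqr_div_eq0 e; rewrite tofrac_eq0.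
apply: polyfun_eqP => a; move/(congr1 (polyfun_eval a)): e.
rewrite rmorphD !rmorphXn rmorph0 /= => /eqP.
by rewrite paddr_eq0 ?sqr_ge0 // sqrf_eq0 => /andP[/eqP].
Qed.

Lemma var_neq0 i : var i != 0.
Proof.
rewrite /var tofrac_eq0; apply/eqP => /(congr1 (polyfun_eval (fun=> 1))).
by rewrite rmorph0 /polyfun_eval /= => /eqP; rewrite oner_eq0.
Qed.

Lemma rational_places : place_family I.
Proof.
exists K var (fun x => residue (dilation x)).
- exact: var_neq0.
- by move=> x; exact: residue1.
- by move=> x; exact: residueB.
- by move=> x; exact: residueM.
- by move=> x z c; apply: residueV; apply: dilation_at1.
- by move=> x z c c'; apply: residue_uniq; apply: dilation_at1.
- exact: residue_var.
- exact: residue_exp_div_uniform.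
- exact: fraction_sum_sqr_eq0.
Qed.

End RationalFunctions.

(** * The ring of patch-continuous functions compatible with specialization *)

Section PlaceFamilyTheory.
Variables (I : Type) (K : place_family I).
Implicit Types (x : set I) (z c : K).

Lemma residue_at0 x : residue_at x (0 : K) 0.
Proof. by rewrite -[0](subrr 1); apply: residue_atB; apply: residue_at1. Qed.

Lemma residue_atX x z c n : residue_at x z c -> residue_at x (z ^+ n) (c ^+ n).
Proof.
move=> zc; elim: n => [|n IHn]; first exact: residue_at1.
by rewrite !exprS; apply: residue_atM.
Qed.

End PlaceFamilyTheory.

Section Spring.
Variables (X : Type) (I : Type) (K : place_family I) (U : I -> set X).

Definition neighbors (x : X) : set I := [set i | U i x].

(** Convergence for the topology that has the sets [U i] and their complements
    as a subbase. *)
Definition patch_limit (F : set_system X) (y : X) : Prop :=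
  forall i, U i y <-> F (U i).

(** The first condition is continuity of [f] for the patch topology and the
    discrete topology of [K]. In the second one [x] is a specialization of [y]
    for the topology generated by [U]; the condition says that [f x] is
    the residue of [f y] at the place of [x]. With [x = y] it forces [f x] to be
    its own residue. *)
Definition spring_pred : {pred X -> K} := fun f =>
  `[< (forall F y, UltraFilter F -> patch_limit F y -> F [set x | f x = f y]) /\
      (forall x y, neighbors x `<=` neighbors y ->
         residue_at (neighbors x) (f y) (f x)) >].

Lemma spring_subring : subring_closed spring_pred.
Proof.
split.
- apply/asboolP; split=> [F y FU _|x y _]; last exact: residue_at1.
  by apply: filterS (filterT : F setT).
- move=> f g /asboolP[fc fs] /asboolP[gc gs]; apply/asboolP; split.
    move=> F y FU Fy; apply: filterS (filterI (fc _ _ FU Fy) (gc _ _ FU Fy)).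
    by move=> x [/= fx gx]; rewrite !fctE fx gx.
  by move=> x y xy; apply: residue_atB; [apply: fs|apply: gs].
- move=> f g /asboolP[fc fs] /asboolP[gc gs]; apply/asboolP; split.
    move=> F y FU Fy; apply: filterS (filterI (fc _ _ FU Fy) (gc _ _ FU Fy)).
    by move=> x [/= fx gx]; rewrite !fctE fx gx.
  by move=> x y xy; apply: residue_atM; [apply: fs|apply: gs].
Qed.

Definition spring : Type := {f | spring_pred f}.

HB.instance Definition _ := SubChoice.on spring.
HB.instance Definition _ :=
  GRing.SubChoice_isSubComPzRing.Build _ _ spring spring_subring.

Definition spring_eval (x : X) (f : spring) : K := val f x.

Lemma spring_eval_zmod x : zmod_morphism (spring_eval x).
Proof. by []. Qed.

Lemma spring_eval_monoid x : monoid_morphism (spring_eval x).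
Proof. by []. Qed.

HB.instance Definition _ x := GRing.isZmodMorphism.Build spring K
  (spring_eval x) (spring_eval_zmod x).
HB.instance Definition _ x := GRing.isMonoidMorphism.Build spring K
  (spring_eval x) (spring_eval_monoid x).

Lemma spring_eqP (f g : spring) :
  (forall x, spring_eval x f = spring_eval x g) -> f = g.
Proof. by move=> fg; apply/val_inj/funext. Qed.

Lemma spring_continuous (f : spring) F y : UltraFilter F -> patch_limit F y ->
  F [set x | spring_eval x f = spring_eval y f].
Proof. by have /asboolP[fc _] := valP f; apply: fc. Qed.

Lemma spring_residue (f : spring) x y : neighbors x `<=` neighbors y ->
  residue_at (neighbors x) (spring_eval y f) (spring_eval x f).
Proof. by have /asboolP[_ fs] := valP f; apply: fs. Qed.

Lemma indicator_spring i :
  spring_pred (fun x => if `[< U i x >] then coordinate K i else 0).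
Proof.
apply/asboolP; split=> [F y FU Fy|x y xy].
- have [Uy|nUy] := pselect (U i y).
    have /Fy := Uy; apply: filterS => x Ux /=.
    by rewrite !asboolT.
  have [/Fy//|] := in_ultra_setVsetC (U i) FU.
  by apply: filterS => x Ux /=; rewrite !asboolF.
- have [Uy|nUy] := pselect (U i y).
    by rewrite (asboolT Uy); apply: residue_at_coordinate.
  rewrite (asboolF nUy) asboolF; first exact: residue_at0.
  by move=> Ux; apply: nUy; apply: xy.
Qed.

Definition indicator i : spring := Sub _ (indicator_spring i).

Definition spring_support (f : spring) : set X := [set x | spring_eval x f != 0].

Lemma support_indicator i : spring_support (indicator i) = U i.
Proof.
apply/seteqP; split=> x; rewrite /spring_support /spring_eval /=.
  by case: asboolP => //; rewrite eqxx.
by move=> Ux; rewrite asboolT // coordinate_neq0.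
Qed.

Hypothesis U_compact : forall F, UltraFilter F -> exists y, patch_limit F y.

(** The exponent depends on the value of [g], but [g] is locally constant on a
    compact space, so that finitely many exponents occur. *)
Lemma spring_exp_div_bound (g : spring) : exists n, forall y,
  spring_eval y g != 0 -> forall (x : set I) t, residue_at x t 0 ->
  residue_at x (t ^+ n / spring_eval y g) 0.
Proof.
pose bound n (z : K) := forall (x : set I) t, residue_at x t 0 ->
  residue_at x (t ^+ n / z) 0.
have boundS m n z : (m <= n)%N -> bound m z -> bound n z.
  move=> mn bm x t xt; rewrite -(subnK mn) exprD -mulrA.
  rewrite -[0](mulr0 (0 ^+ (n - m))); apply: residue_atM; last exact: bm.
  exact: residue_atX.
pose A n := [set y | spring_eval y g != 0 -> bound n (spring_eval y g)].
suff [n An] : exists n, A n = setT.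
  by exists n => y; have : A n y by rewrite An.
apply: contrapT => /forallNP nA.
have PF : ProperFilter (filter_from setT (fun n => ~` A n)).
  apply: filter_from_proper; last first.
    move=> n _; apply: contrapT => /set0P/negP/negPn/eqP AC0.
    by apply: (nA n); rewrite -[LHS]setCK AC0 setC0.
  apply: filter_from_filter; first by exists 0%N.
  move=> m n _ _; exists (maxn m n) => // y nAy.
  by split=> Ay; apply: nAy => gy0; [apply: (@boundS m)|apply: (@boundS n)];
     rewrite ?leq_maxl ?leq_maxr //; apply: Ay.
have [F [FU sF]] := ultraFilterLemma PF.
have [y Fy] := U_compact FU.
have [n bn] : exists n, A n y.
  have [g0|gn0] := eqVneq (spring_eval y g) 0.
    by exists 0%N; rewrite /A /= g0 eqxx.
  by have [n bn] := residue_at_exp_div gn0; exists n.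
have FA : F (~` A n) by apply: sF; exists n.
have [z [/= nAz ezy]] := filter_ex (filterI FA (spring_continuous g FU Fy)).
by apply: nAz; rewrite /A /= ezy.
Qed.

(** Inclusions of supports are explained by divisibility: the quotient is
    [f ^+ n.+1 / g], extended by [0]. When [g] vanishes at a specialization [x]
    of [y], so does [f], and [f y ^+ n.+1] is more divisible than [g y]. *)
Lemma spring_dvd_exp (f g : spring) : spring_support f `<=` spring_support g ->
  exists n h, f ^+ n.+1 = h * g.
Proof.
move=> fg; have [n Hn] := spring_exp_div_bound g.
have fg0 y : spring_eval y g = 0 -> spring_eval y f = 0.
  move=> gy; apply/eqP/negPn/negP => fy; have := fg _ fy.
  by rewrite /spring_support /= gy eqxx.
pose h x := spring_eval x f ^+ n.+1 / spring_eval x g.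
have hP : spring_pred h.
  apply/asboolP; split=> [F y FU Fy|x y xy].
    apply: filterS (filterI (spring_continuous f FU Fy) (spring_continuous g FU Fy)).
    by move=> x [/= fx gx]; rewrite /h fx gx.
  have xyf := spring_residue f xy; have xyg := spring_residue g xy.
  have [gx0|gxn0] := eqVneq (spring_eval x g) 0; last first.
    by apply: residue_atM (residue_atX _ xyf) (residue_atV gxn0 xyg).
  rewrite /h gx0 invr0 mulr0.
  have [gy0|gyn0] := eqVneq (spring_eval y g) 0.
    by rewrite gy0 invr0 mulr0; apply: residue_at0.
  (* The spare factor [f y] has residue [f x = 0]. *)
  rewrite exprS -mulrA; rewrite (fg0 _ gx0) in xyf.
  by rewrite -[0](mulr0 0); apply: residue_atM (Hn _ gyn0 _ _ xyf).
exists n, (Sub h hP); apply: spring_eqP => x; rewrite rmorphXn rmorphM /=.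
rewrite [X in _ = X * _]/spring_eval /= /h.
have [gx0|gxn0] := eqVneq (spring_eval x g) 0; last by rewrite divfK.
by rewrite gx0 mulr0 (fg0 _ gx0) expr0n.
Qed.

(** The zero sets of the members of [P] and the supports of the nonmembers have
    the finite intersection property, by [spring_dvd_exp]; a point in all of
    them, obtained by compactness, is one at which exactly [P] vanishes. *)
Lemma spring_prime_point (P : set spring) : prime_ideal P ->
  exists y, P = [set f | spring_eval y f = 0].
Proof.
move=> [P0 PD PM P1 Pprime].
have Pexp f n : P (f ^+ n) -> P f.
  elim: n => [/P1//|n IHn]; rewrite exprS => /Pprime[//|]; exact: IHn.
pose base := [set fg : spring * spring | P fg.1 /\ ~ P fg.2].
pose B (fg : spring * spring) := spring_support fg.2 `\` spring_support fg.1.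
have PF : ProperFilter (filter_from base B).
  apply: filter_from_proper; last first.
    move=> [f g] [/= Pf nPg]; apply: contrapT => /set0P/negP/negPn/eqP.
    rewrite /B /= setD_eq0 => /spring_dvd_exp[n [h e]].
    by apply: nPg; apply: (@Pexp _ n.+1); rewrite e; apply: PM.
  apply: filter_from_filter; first by exists (0, 1).
  move=> [f g] [f' g'] [/= Pf nPg] [/= Pf' nPg'].
  (* A sum of squares vanishes exactly where both terms do. *)
  exists (f ^+ 2 + f' ^+ 2, g * g').
    split=> /=; last by move=> /Pprime[].
    by rewrite !expr2; apply: PD; apply: PM.
  move=> x; rewrite /B /spring_support /= !(rmorphD, rmorphM, rmorphXn) /=.
  rewrite mulf_eq0 negb_or => -[/andP[gx g'x] /negP/negPn/eqP s0].
  have f0 := sum_sqr_eq0 s0.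
  rewrite addrC in s0; have f'0 := sum_sqr_eq0 s0.
  by rewrite f0 f'0 eqxx.
have [F [FU sF]] := ultraFilterLemma PF.
have [y Fy] := U_compact FU; exists y; apply/seteqP; split=> f /=.
  move=> Pf; have FB : F (B (f, 1)) by apply: sF; exists (f, 1).
  have [z [[_ /negP/negPn/eqP fz] <-]] :=
    filter_ex (filterI FB (spring_continuous f FU Fy)).
  exact: fz.
move=> fy; apply: contrapT => nPf.
have FB : F (B (0, f)) by apply: sF; exists (0, f).
have [z [[/= fz _] ezy]] := filter_ex (filterI FB (spring_continuous f FU Fy)).
by move: fz; rewrite /spring_support /= ezy fy eqxx.
Qed.

Lemma spring_point_prime (y : X) : prime_ideal [set f | spring_eval y f = 0].
Proof.
split=> /=; rewrite ?rmorph0 ?rmorph1 //.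
- by move=> f g; rewrite rmorphD /= => -> ->; rewrite addr0.
- by move=> f g; rewrite rmorphM /= => ->; rewrite mulr0.
- by apply/eqP/oner_neq0.
- by move=> f g; rewrite rmorphM /= => /eqP; rewrite mulf_eq0 => /orP[]/eqP; [left|right].
Qed.

End Spring.

(** A form of Hochster's theorem: a [T0] space with a subbase [U] whose patch
    topology is compact is spectral. *)
Theorem patch_compact_spectral (X : topologicalType) (I : choiceType) (U : I -> set X)
    (U_open : forall i, open (U i))
    (U_base : forall O x, open O -> O x -> exists s : seq I,
       (forall i, i \in s -> U i x) /\
       forall y, (forall i, i \in s -> U i y) -> O y)
    (U_sep : forall x y, (forall i, U i x <-> U i y) -> x = y)
    (U_compact : forall F, UltraFilter F -> exists y, patch_limit U F y) :
  spectral_space X.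
Proof.
have K := rational_places I.
(* A support is closed and open for the patch topology and stable under
   generization; were [x] not interior, compactness would give a generization
   [y] of [x] outside the support. *)
have support_open (f : spring K U) : open (spring_support f).
  rewrite openE => x fx; apply: contrapT => nx.
  have PF : ProperFilter (within (~` spring_support f) (nbhs x)).
    split; last exact: within_filter.
    by rewrite /within /= => w; apply: nx; apply: filterS w => z /contrapT.
  have [F [FU sF]] := ultraFilterLemma PF.
  have [y Fy] := U_compact _ FU.
  have xy : neighbors U x `<=` neighbors U y.
    move=> i Ux; apply/Fy/sF; rewrite /within /=.
    by apply: filterS (open_nbhs_nbhs (conj (U_open i) Ux)) => z.
  have nFy : spring_eval y f != 0.
    have := spring_residue f xy; apply: contraPneq => y0.
    rewrite y0 => /(residue_at_uniq (residue_at0 K _)) x0.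
    by move: fx; rewrite /spring_support /= -x0 eqxx.
  have FC : F (~` spring_support f) by apply: sF; apply: withinT.
  have [z [/= + ezy]] := filter_ex (filterI FC (spring_continuous f FU Fy)).
  by rewrite /spring_support /= ezy.
have support_base (O : set X) x : open O -> O x ->
    exists f : spring K U, spring_support f x /\ spring_support f `<=` O.
  move=> Oo Ox; have [s [sx sO]] := U_base _ _ Oo Ox.
  suff [f [fx fs]] : exists f : spring K U, spring_support f x /\
      forall y, spring_support f y -> forall i, i \in s -> U i y.
    by exists f; split=> // y /fs; apply: sO.
  elim: s sx {sO} => [_|i s IHs sx].
    by exists 1; split=> //; rewrite /spring_support /= rmorph1 oner_neq0.
  have [j js|f [fx fs]] := IHs; first by apply: sx; rewrite inE js orbT.
  exists (indicator K U i * f).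
  have fI y : spring_support (indicator K U i * f) y <-> U i y /\ spring_support f y.
    rewrite -(support_indicator K U i) /spring_support /= rmorphM mulf_eq0 negb_or.
    by split=> [/andP[]|[-> ->]].
  split; first by apply/fI; split=> //; apply: sx; rewrite inE eqxx.
  by move=> y /fI[Uy /fs sy] j; rewrite inE => /predU1P[->|/sy].
pose to x : Spec (spring K U) := exist _ _ (spring_point_prime K U x).
have /choice[from fromK] : forall P : Spec (spring K U), exists x, to x = P.
  move=> [P pP]; have [y eP] := spring_prime_point U_compact pP; exists y.
  by apply: eq_exist; rewrite eP.
have toE x f : sval (to x) f <-> ~ spring_support f x.
  by rewrite /spring_support /=; split=> [->|/negP/negPn/eqP]; first by rewrite eqxx.
have toK : cancel to from.
  move=> x; apply: U_sep => i.
  have : sval (to (from (to x))) (indicator K U i) <-> sval (to x) (indicator K U i).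
    by rewrite fromK.
  rewrite !toE support_indicator => e.
  by split=> Ux; apply: contrapT => /e; apply.
exists (spring K U), to, from; split=> //.
- apply/continuousP => W [E eW].
  suff -> : to @^-1` W = \bigcup_(f in E) spring_support f.
    exact: bigcup_open.
  rewrite -[W]setCK eW; apply/seteqP; split=> x /=.
    move=> /existsNP[f /not_implyP[Ef nf]]; exists f => //.
    by apply: contrapT => /toE.
  by move=> [f Ef fx] /(_ _ Ef)/toE.
- apply/continuousP => O Oo; exists [set f | spring_support f `<=` O].
  apply/seteqP; split=> P; rewrite -(fromK P); set x := from P => /=.
    rewrite toK => nO f fO; apply/toE => /fO; exact: nO.
  rewrite toK => EP Ox; have [f [fx fO]] := support_base _ _ Oo Ox.
  by have /toE := EP f fO.
Qed.

(** * The hull-kernel topology *)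

Section HullKernel.
Variable S : choiceType.

Lemma hk_open_notin (s : S) : open [set R : hk_powerset S | ~ R s].
Proof.
exists [set [set R : hk_powerset S | ~ R s]]; last by rewrite bigcup_set1.
move=> _ ->; exists [fset ([set s] : set S)]%fset.
  by move=> F /fset1P ->; apply/mem_set; apply: finite_set1.
by rewrite set_fset1 bigcap_set1; apply/seteqP; split=> R /=; rewrite sub1set inE.
Qed.

(** A finite set [F] not contained in [R] may be replaced by one of its elements
    outside [R], so that the conditions [~ R x] already generate the topology. *)
Lemma hk_open_base (O : set (hk_powerset S)) (R : hk_powerset S) :
  open O -> O R -> exists s : seq S, (forall x, x \in s -> ~ R x) /\
    forall R' : hk_powerset S, (forall x, x \in s -> ~ R' x) -> O R'.
Proof.
move=> [D sD <-] [B DB BR]; have [E _ eB] := sD _ DB.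
suff [s [sR sE]] : exists s : seq S, (forall x, x \in s -> ~ R x) /\
    forall R' : hk_powerset S, (forall x, x \in s -> ~ R' x) ->
      forall F, F \in (E : seq (set S)) -> ~ F `<=` R'.
  by exists s; split=> // R' /sE sR'; exists B => //; rewrite -eB.
have : forall F, F \in (E : seq (set S)) -> ~ F `<=` R.
  by move=> F FE; rewrite -eB in BR; apply: BR.
elim: (E : seq _) => [|F s IHs] Fs; first by exists [::].
have [F' F's|s' [s'R s's]] := IHs; first by apply: Fs; rewrite inE F's orbT.
have /existsNP[x /not_implyP[Fx nRx]] := Fs F (mem_head _ _).
exists (x :: s'); split=> [y|R' sR' F'].
  by rewrite inE => /predU1P[->|/s'R].
rewrite inE => /predU1P[-> FR'|]; first by apply: (sR' x (mem_head _ _)); apply: FR'.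
by apply: s's => y ys'; apply: sR'; rewrite inE ys' orbT.
Qed.

End HullKernel.

(** * Ultrafilter limits of valuation monoids *)

Lemma fmap_ultra (T T' : Type) (f : T -> T') (F : set_system T) :
  UltraFilter F -> UltraFilter (f @ F).
Proof.
move=> FU; split=> [|H PH sH]; first exact: fmap_proper_filter.
apply/seteqP; split=> // A HA.
have [//|FC] := in_ultra_setVsetC (f @^-1` A) FU.
by have [z []] := filter_ex (filterI HA (sH (~` A) FC)).
Qed.

Section ValuationMonoids.
Local Open Scope group_scope.
Variable G : groupType.
Implicit Types A B : set (adjoin0 G).

(** Subsets of [adjoin0 G] are cancellative because [G] is a group, and the last
    condition yields [completion B = setT]. The conditions that remain are
    closure conditions, each involving finitely many elements. *)
Lemma valuation_monoids_overP A B : valuation_monoids_over A B <->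
  [/\ submonoid B, A `<=` B & forall g : G, B (Some g) \/ B (Some g^-1)].
Proof.
split=> [[[mB _ vB] AB cB]|[mB AB tB]].
  by split=> // g; apply: (vB (Some g)) => //; rewrite cB.
have [B0 B1 BM] := mB.
have cB : completion B = setT.
  apply/seteqP; split=> // x _; case: x => [g|]; last by exists bp, 1.
  have [Bg|Bg] := tB g.
    exists (Some g), 1; split=> //; change (Some g = Some (g * 1^-1)).
    by rewrite invg1 mulg1.
  exists 1, (Some g^-1); split=> //; change (Some g = Some (1 * g^-1^-1)).
  by rewrite invgK mul1g.
split=> //; split=> //.
  by move=> [a|] [b|] [c|] // _ _ _ _ [] /mulgI->.
by move=> [g|//] _ _; apply: tB.
Qed.

(** An ultrafilter decides which of [Some g] and [Some g^-1] belongs to almost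
    all members; the other closure conditions pass to the limit for any filter. *)
Lemma ultrafilter_limit_valuation_monoid A (F : set_system (set (adjoin0 G))) :
  UltraFilter F -> F (valuation_monoids_over A) ->
  valuation_monoids_over A [set x | F [set B | B x]].
Proof.
move=> FU FA; apply/valuation_monoids_overP; split=> [|x Ax|g] /=.
- split=> /= [||x y Fx Fy].
  + by apply: filterS FA => B /valuation_monoids_overP[[]].
  + by apply: filterS FA => B /valuation_monoids_overP[[]].
  + apply: filterS (filterI FA (filterI Fx Fy)).
    by move=> B [/valuation_monoids_overP[[_ _ BM] _ _] [Bx By]]; apply: BM.
- by apply: filterS FA => B /valuation_monoids_overP[_ AB _]; apply: AB.
- have [Fg|nFg] := in_ultra_setVsetC [set B | B (Some g)] FU; first by left.
  right; apply: filterS (filterI FA nFg) => B [/valuation_monoids_overP[_ _ tB]].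
  by move=> nBg; have [/nBg|] := tB g.
Qed.

End ValuationMonoids.

Theorem proposition5p3 (G : groupType) (hG : forall x y : G, (x * y = y * x)%g)
    (A : set (adjoin0 G)) (hA : submonoid A) :
  spectral_space
    (set_type (valuation_monoids_over A : set (hk_powerset (adjoin0 G)))).
Proof.
set V := valuation_monoids_over A.
apply: (@patch_compact_spectral _ (adjoin0 G)
  (fun x => [set B : set_type (V : set (hk_powerset _)) | ~ (val B : set _) x])).
- move=> x; exists [set R : hk_powerset (adjoin0 G) | ~ R x] => //.
  exact: hk_open_notin.
- move=> _ B [O Oo <-] /= OB; have [s [sB sO]] := hk_open_base Oo OB.
  by exists s; split=> // B' sB'; apply: sO.
- move=> B B' BB'; apply: val_inj; apply/seteqP; split=> x Bx;
    by apply: contrapT => /BB'.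
move=> F FU.
pose E := (set_val : set_type (V : set (hk_powerset _)) -> set (adjoin0 G)) @ F.
have EU : UltraFilter E by apply: fmap_ultra.
have VE : V [set x | E [set B | B x]].
  apply: ultrafilter_limit_valuation_monoid.
  by apply: (@filterS _ F _ setT) => [B _|]; [exact: set_valP|exact: filterT].
exists (SigSub (mem_set VE)) => x /=; split=> [nEx|Fx Ex].
  by have [/nEx|] := in_ultra_setVsetC [set B | B x] EU.
by have [B []] := @filter_ex _ F _ _ (@filterI _ F _ _ _ Ex Fx).
Qed.
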